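(* Let $\mathcal{S}$ be a non-overlapping PTRS. Then $\mathcal{S}$ is iAST if and only if $\mathcal{S}$ is liAST, and $\mathcal{S}$ is iPAST if and only if $\mathcal{S}$ is liPAST.
   Context: Terms are built over a signature $\Sigma$ and variables $\mathcal{V}$. A finite multi-distribution $\mu$ on a nonempty set $A$ is a finite multiset of pairs $(p:a)$ with $0<p\le 1$, $a\in A$, $\sum_{(p:a)\in\mu}p=1$; $\operatorname{Supp}(\mu)$ is the multiset of the $a$'s; $p\cdot\mu=\{(pq:a)\mid(q:a)\in\mu\}$. A probabilistic rewrite rule is $\ell\to\mu$ with $\ell$ a non-variable term, $\mu$ a finite multi-distribution on terms, and all variables of each $r\in\operatorname{Supp}(\mu)$ occurring in $\ell$. A PTRS is a (possibly infinite) set $\mathcal{S}$ of such rules. $s\to_{\mathcal{S}}\{p_1:t_1,\dots,p_k:t_k\}$ if there are a position $\pi$, a rule $\ell\to\{p_1:r_1,\dots,p_k:r_k\}\in\mathcal{S}$, a substitution $\sigma$ with $s|_\pi=\ell\sigma$ and $t_j=s[r_j\sigma]_\pi$. The step is innermost if all proper subterms of $\ell\sigma$ are normal forms w.r.t. $\mathcal{S}$. For parallel positions $\tau,\pi$ with longest common prefix $\chi$, write $\tau\prec\pi$ if $i<j$ for the unique $i,j$ with $\chi.i\le\tau$ and $\chi.j\le\pi$ (prefix order). An innermost step at position $\pi$ is leftmost innermost if there is no redex at any position $\tau$ with $\tau\prec\pi$. The lifting $\rightrightarrows$ of a relation $\to$ from terms to multi-distributions is the smallest relation on finite multi-distributions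 with: $\{1:t\}\rightrightarrows\{1:t\}$ if $t$ is a normal form w.r.t. $\to$; $\{1:t\}\rightrightarrows\mu$ if $t\to\mu$; and if $\mu_j\rightrightarrows\nu_j$, $0<p_j\le1$, $\sum_jp_j=1$, then $\bigcup_jp_j\cdot\mu_j\rightrightarrows\bigcup_jp_j\cdot\nu_j$. $|\mu|_{\mathcal{S}}$ is the total probability in $\mu$ of terms that are normal forms w.r.t. $\mathcal{S}$; for an infinite sequence $\vec\mu=(\mu_n)_n$, $\operatorname{edl}(\vec\mu)=\sum_{n=0}^\infty(1-|\mu_n|_{\mathcal{S}})$. $\mathcal{S}$ is iAST (resp. liAST) if every infinite sequence $(\mu_n)_n$ with $\mu_n\rightrightarrows\mu_{n+1}$ for the lifting of innermost (resp. leftmost innermost) rewriting with $\mathcal{S}$ satisfies $\lim_n|\mu_n|_{\mathcal{S}}=1$; it is iPAST (resp. liPAST) if every such sequence has finite $\operatorname{edl}$. Two rules (variables renamed apart) overlap if some non-variable subterm $\ell_1|_\pi$ of one left-hand side unifies with the other left-hand side $\ell_2$ (with $\pi\ne\varepsilon$ if it is the same rule); $\mathcal{S}$ is non-overlapping if no rules overlap. *)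

(* Defs.v *)
From HB Require Import structures.
From mathcomp Require Import all_boot all_order all_algebra.
From mathcomp Require Import finmap multiset.
From mathcomp Require Import all_classical all_reals all_analysis.

Set Implicit Arguments.
Unset Strict Implicit.
Unset Printing Implicit Defensive.

Import Order.TTheory GRing.Theory Num.Theory.
Import numFieldNormedType.Exports.
Local Open Scope classical_set_scope.
Local Open Scope mset_scope.
Local Open Scope ring_scope.

Section MultiDistributions.
Context {R : realType} {A : choiceType}.
Implicit Types (M N : {mset R * A}).

Definition is_mdist M : bool :=
  all (fun x : R * A => 0 < x.1 <= 1) M && (\sum_(x <- M) x.1 == 1).

Record mdist := MDist { mdval :> {mset R * A}; mdistP : is_mdist mdval }.

HB.instance Definition _ := [isSub for mdval].
HB.instance Definition _ := [Choice of mdist by <:].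

Definition Supp (mu : mdist) : {mset A} := seq_mset [seq x.2 | x <- mu].

Fact dirac_subproof (a : A) : is_mdist [mset (1, a)].
Proof.
have P : perm_eq (enum_mset [mset ((1 : R), a)]) [:: (1, a)].
  by rewrite enum_msetn.
rewrite /is_mdist (perm_all _ P) (perm_big _ P) /= big_seq1 eqxx andbT andbT.
by rewrite ltr01 lexx.
Qed.
Definition mdirac (a : A) : mdist := MDist (dirac_subproof a).

Definition mscale (p : R) M : {mset R * A} :=
  seq_mset [seq (p * x.1, x.2) | x <- M].

Lemma perm_msetD M N : perm_eq (M `+` N) (M ++ N).
Proof.
by apply/allP => x _ /=; rewrite count_cat !count_mem_mset msetE2.
Qed.

Lemma mscale_mass (p : R) M :
  \sum_(x <- mscale p M) x.1 = p * \sum_(x <- M) x.1.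
Proof. by rewrite (perm_big _ (perm_eq_seq_mset _)) /= big_map mulr_sumr. Qed.

Fact mmix_subproof n (p : 'I_n -> R) (mu : 'I_n -> mdist) :
  (forall j, 0 < p j <= 1) -> \sum_j p j = 1 ->
  is_mdist (\big[msetD/mset0]_j mscale (p j) (mu j)).
Proof.
move=> p01 p1; apply/andP; split.
  apply: (@big_ind _ (fun M : {mset R * A} =>
      all (fun x : R * A => 0 < x.1 <= 1) M)).
  - by rewrite enum_mset0.
  - by move=> M N hM hN; rewrite (perm_all _ (perm_msetD _ _)) all_cat hM hN.
  - move=> j _; rewrite (perm_all _ (perm_eq_seq_mset _)) all_map.
    have /andP[/allP hmu _] := mdistP (mu j).
    apply/allP => x /hmu /andP[x0 x1] /=.
    have /andP[pj0 pj1] := p01 j.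
    by rewrite mulr_gt0 // mulr_ile1 // ltW.
have -> : \sum_(x <- \big[msetD/mset0]_j mscale (p j) (mu j)) x.1
    = \sum_j p j.
  apply: (@big_ind2 _ _ (fun (M : {mset R * A}) (q : R) =>
      \sum_(x <- M) x.1 = q)).
  - by rewrite enum_mset0 big_nil.
  - move=> M q N q' <- <-.
    by rewrite (perm_big _ (perm_msetD _ _)) big_cat.
  - move=> j _; rewrite mscale_mass.
    by have /andP[_ /eqP ->] := mdistP (mu j); rewrite mulr1.
by rewrite p1.
Qed.

(* mmix p01 p1 mu is the convex combination \bigcup_j p_j * mu_j. *)
Definition mmix n (p : 'I_n -> R) (p01 : forall j, 0 < p j <= 1)
    (p1 : \sum_j p j = 1) (mu : 'I_n -> mdist) : mdist :=
  MDist (mmix_subproof mu p01 p1).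

End MultiDistributions.
Arguments mdist : clear implicits.

Fact mdmap_subproof (R : realType) (A B : choiceType) (f : A -> B)
  (mu : mdist R A) :
  is_mdist (seq_mset [seq (x.1, f x.2) | x <- mu] : {mset R * B}).
Proof.
have P := perm_eq_seq_mset [seq (x.1, f x.2) | x <- mu].
rewrite /is_mdist (perm_all _ P) (perm_big _ P) /= all_map big_map.
exact: mdistP mu.
Qed.

(* {p_1 : f a_1, ..., p_k : f a_k}; outcomes identified by f are not merged. *)
Definition mdmap (R : realType) (A B : choiceType) (f : A -> B)
    (mu : mdist R A) : mdist R B :=
  MDist (mdmap_subproof f mu).

Inductive lifting (R : realType) (A : choiceType)
    (step : A -> mdist R A -> Prop) : mdist R A -> mdist R A -> Prop :=
| lifting_nf a : (forall mu, ~ step a mu) ->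
    lifting step (mdirac a) (mdirac a)
| lifting_step a mu : step a mu ->
    lifting step (mdirac a) mu
| lifting_mix n (p : 'I_n -> R) (p01 : forall j, 0 < p j <= 1)
    (p1 : \sum_j p j = 1) (mu nu : 'I_n -> mdist R A) :
    (forall j, lifting step (mu j) (nu j)) ->
    lifting step (mmix p01 p1 mu) (mmix p01 p1 nu).

Record signature := Signature { symb : Type; arity : symb -> nat }.

Inductive term (Sig : signature) (V : Type) : Type :=
| Var (x : V)
| App (f : symb Sig) (ts : 'I_(arity f) -> term Sig V).
Arguments Var {Sig V} x.
Arguments App {Sig V} f ts.

HB.instance Definition _ Sig V := gen_eqMixin (term Sig V).
HB.instance Definition _ Sig V := gen_choiceMixin (term Sig V).

Section Terms.
Context {Sig : signature} {V : Type}.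
Implicit Types (s t u : term Sig V).

Definition is_var t : Prop := exists x, t = Var x.

Fixpoint occurs (x : V) t : Prop :=
  match t with
  | Var y => x = y
  | App f ts => exists i, occurs x (ts i)
  end.

Fixpoint subst (W : Type) (sigma : V -> term Sig W) t : term Sig W :=
  match t with
  | Var x => sigma x
  | App f ts => App f (fun i => subst sigma (ts i))
  end.

(* Positions are sequences of argument indices, counted from 0. *)
Fixpoint subterm_at t (pi : seq nat) : option (term Sig V) :=
  match pi, t with
  | [::], _ => Some t
  | i :: pi', App f ts =>
      if insub i is Some j then subterm_at (ts j) pi' else None
  | _ :: _, Var _ => None
  end.

(* t[u]_pi; equal to t when pi is not a position of t. *)
Fixpoint replace_at t (pi : seq nat) u : term Sig V :=
  match pi, t with
  | [::], _ => u
  | i :: pi', App f ts =>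
      App f (fun j => if val j == i then replace_at (ts j) pi' u else ts j)
  | _ :: _, Var _ => t
  end.

Definition proper_subterm u t : Prop :=
  exists2 pi, pi != [::] & subterm_at t pi = Some u.

(* No finiteness of the domain is required of substitutions: a finite term
   only sees finitely many variables. *)
Definition unifiable s t : Prop :=
  exists sigma : V -> term Sig V, subst sigma s = subst sigma t.

End Terms.

Definition parallel (tau pi : seq nat) : bool :=
  ~~ prefix tau pi && ~~ prefix pi tau.

Fixpoint lcprefix (tau pi : seq nat) : seq nat :=
  match tau, pi with
  | i :: tau', j :: pi' => if i == j then i :: lcprefix tau' pi' else [::]
  | _, _ => [::]
  end.

Definition left_of (tau pi : seq nat) : Prop :=
  parallel tau pi /\
  exists i j : nat, [/\ prefix (rcons (lcprefix tau pi) i) tau,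
    prefix (rcons (lcprefix tau pi) j) pi & (i < j)%N].

Record prule (R : realType) (Sig : signature) (V : Type) := PRule {
  lhs : term Sig V;
  rhs : mdist R (term Sig V);
  lhs_nonvar : ~ is_var lhs;
  rhs_vars : forall r, r \in Supp rhs -> forall x, occurs x r -> occurs x lhs
}.

Definition PTRS (R : realType) (Sig : signature) (V : Type) :=
  set (prule R Sig V).

Section Rewriting.
Context {R : realType} {Sig : signature} {V : Type}.
Variable S : PTRS R Sig V.
Local Notation T := (term Sig V).
Implicit Types (s t : T) (mu : mdist R T) (pi tau : seq nat).

Definition rewrites_at pi (r : prule R Sig V) (sigma : V -> T) s mu : Prop :=
  [/\ S r, subterm_at s pi = Some (subst sigma (lhs r)) &
      mu = mdmap (fun t => replace_at s pi (subst sigma t)) (rhs r)].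

Definition step s mu : Prop :=
  exists pi r sigma, rewrites_at pi r sigma s mu.

Definition normal_form t : Prop := forall mu, ~ step t mu.

Definition redex t : Prop :=
  exists r sigma, S r /\ t = subst sigma (lhs r).

Definition istep_at pi s mu : Prop :=
  exists r sigma, rewrites_at pi r sigma s mu /\
    forall u, proper_subterm u (subst sigma (lhs r)) -> normal_form u.

Definition istep s mu : Prop := exists pi, istep_at pi s mu.

Definition listep s mu : Prop :=
  exists pi, istep_at pi s mu /\
    forall tau u, left_of tau pi -> subterm_at s tau = Some u -> ~ redex u.

Definition nf_prob mu : R := \sum_(x <- mu | `[< normal_form x.2 >]) x.1.

Definition edl (mu : nat -> mdist R T) : \bar R :=
  (\sum_(0 <= n <oo) (1 - nf_prob (mu n))%:E)%E.

Definition rewrite_seq (red : T -> mdist R T -> Prop)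
    (mu : nat -> mdist R T) : Prop :=
  forall n, lifting red (mu n) (mu n.+1).

Definition iAST : Prop :=
  forall mu : nat -> mdist R T,
    rewrite_seq istep mu -> nf_prob (mu n) @[n --> \oo] --> (1 : R).

Definition liAST : Prop :=
  forall mu : nat -> mdist R T,
    rewrite_seq listep mu -> nf_prob (mu n) @[n --> \oo] --> (1 : R).

Definition iPAST : Prop :=
  forall mu : nat -> mdist R T,
    rewrite_seq istep mu -> (edl mu < +oo)%E.

Definition liPAST : Prop :=
  forall mu : nat -> mdist R T,
    rewrite_seq listep mu -> (edl mu < +oo)%E.

(* The two rules are renamed apart by tagging their variables in V + V. *)
Definition overlap (r1 r2 : prule R Sig V) : Prop :=
  let l1 : term Sig (V + V) := subst (fun x => Var (inl x)) (lhs r1) in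
  let l2 : term Sig (V + V) := subst (fun x => Var (inr x)) (lhs r2) in
  exists pi u, [/\ subterm_at l1 pi = Some u, ~ is_var u, unifiable u l2 &
    r1 = r2 -> pi <> [::]].

Definition non_overlapping : Prop :=
  forall r1 r2, S r1 -> S r2 -> ~ overlap r1 r2.

End Rewriting.

(* Main.v *)
From Pilot Require Import Defs.
From mathcomp Require Import all_boot all_order all_algebra.
From mathcomp Require Import finmap multiset.
From mathcomp Require Import all_classical all_reals all_analysis.

(* Innermost redexes of a non-overlapping PTRS satisfy a one-step diamond
   property: two of them at different positions are parallel, so contracting
   one leaves the other an innermost redex in every outcome and the two steps
   commute; two of them at the same position are contracted by the same rule.
   Hence the probability of having reached a normal form after n innermost
   steps depends only on the start term, not on the strategy.  A leftmost
   innermost sequence exists from every start, so the sequences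
   n |-> |mu_n| arising from both kinds of rewriting are the same. *)

Set Implicit Arguments.
Unset Strict Implicit.
Unset Printing Implicit Defensive.

Import Order.TTheory GRing.Theory Num.Theory.
(* all_analysis shadows mdist. *)
Import Pilot.Defs.
Local Open Scope mset_scope.
Local Open Scope ring_scope.

(** * Expectations over finite multi-distributions *)

Section Expectation.
Context {R : realType} {A : choiceType}.
Implicit Types (mu nu : mdist R A) (f : A -> R).

Definition expect mu f : R := \sum_(x <- mu) x.1 * f x.2.

Lemma expect_dirac a f : expect (mdirac a) f = f a.
Proof.
by rewrite /expect /= big_msetn /= mul1r.
Qed.

Lemma expect_mix n (p : 'I_n -> R) (p01 : forall j, 0 < p j <= 1)
    (p1 : \sum_j p j = 1) (mu : 'I_n -> mdist R A) f :
  expect (mmix p01 p1 mu) f = \sum_j p j * expect (mu j) f.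
Proof.
rewrite /expect /=.
apply: (@big_ind2 _ _ (fun (M : {mset R * A}) (q : R) =>
    \sum_(x <- M) x.1 * f x.2 = q)).
- by rewrite enum_mset0 big_nil.
- by move=> M q N q' <- <-; rewrite (perm_big _ (perm_msetD _ _)) big_cat.
- move=> j _; rewrite (perm_big _ (perm_eq_seq_mset _)) big_map mulr_sumr.
  by apply: eq_bigr => x _ /=; rewrite mulrA.
Qed.

Lemma eq_expect mu f g : f =1 g -> expect mu f = expect mu g.
Proof. by move=> fg; apply: eq_bigr => x _; rewrite fg. Qed.

(** One summand per element of the multiset, weighted by its probability. The basic clauses of
    [lifting] start from Dirac distributions, so this makes every start liftable. *)
Lemma mdist_dirac_mix mu :
  {n : nat & {p : 'I_n -> R & {p01 : forall j, 0 < p j <= 1 &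
    {p1 : \sum_j p j = 1 & {a : 'I_n -> A |
      mu = mmix p01 p1 (fun j => mdirac (a j))}}}}}.
Proof.
case: mu => M M_mdist; have /andP[/allP M01 /eqP M1] := M_mdist.
exists (size M); exists (fun j => (tnth (in_tuple M) j).1).
have p01 j : 0 < (tnth (in_tuple M) j).1 <= 1.
  by apply: M01; exact: (mem_tnth j (in_tuple M)).
exists p01.
have p1 : \sum_j (tnth (in_tuple M) j).1 = 1 by rewrite -M1 [RHS]big_tnth.
exists p1; exists (fun j => (tnth (in_tuple M) j).2); apply: val_inj => /=.
rewrite -[LHS]seq_mset_id.
under eq_bigr => j _.
  rewrite /mscale enum_msetn /= mulr1 -surjective_pairing.
  over.
rewrite -(big_tnth _ _ M predT (fun x => seq_mset [:: x])).
elim: (enum_mset M) => [|x s IHs].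
  by rewrite big_nil; apply/msetP => y; rewrite mset_seqE mset0E.
rewrite big_cons -IHs; apply/msetP => y.
by rewrite msetE2 !mset_seqE /= addn0.
Qed.

End Expectation.

Lemma exchange_expect {R : realType} {A B : choiceType} (mu : mdist R A)
    (nu : mdist R B) (F : A -> B -> R) :
  expect mu (fun a => expect nu (F a)) =
  expect nu (fun b => expect mu (F ^~ b)).
Proof.
rewrite /expect; under eq_bigr do rewrite mulr_sumr.
under [RHS]eq_bigr do rewrite mulr_sumr.
rewrite exchange_big; apply: eq_bigr => x _; apply: eq_bigr => y _ /=.
by rewrite mulrCA.
Qed.

Lemma expect_map {R : realType} {A B : choiceType} (g : A -> B)
    (mu : mdist R A) (f : B -> R) :
  expect (mdmap g mu) f = expect mu (f \o g).
Proof. by rewrite /expect (perm_big _ (perm_eq_seq_mset _)) big_map. Qed.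

Lemma eq_in_mdmap {R : realType} {A B : choiceType} (g h : A -> B)
    (mu : mdist R A) :
  (forall a, a \in Supp mu -> g a = h a) -> mdmap g mu = mdmap h mu.
Proof.
move=> gh; apply: val_inj => /=; congr seq_mset.
apply/seq.eq_in_map => x xmu; rewrite gh//.
by rewrite /Supp (perm_mem (perm_eq_seq_mset _)) map_f.
Qed.

Lemma mdmap_comp {R : realType} {A B C : choiceType} (g : B -> C) (h : A -> B)
    (mu : mdist R A) :
  mdmap g (mdmap h mu) = mdmap (g \o h) mu.
Proof.
apply: val_inj => /=; apply/eq_seq_msetP.
by rewrite (perm_trans (perm_map _ (perm_eq_seq_mset _)))// -map_comp.
Qed.

(** * Lifting a relation to multi-distributions *)

Section Lifting.
Context {R : realType} {A : choiceType}.
Implicit Types (step : A -> mdist R A -> Prop) (mu : mdist R A).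

Lemma lifting_total step mu : exists nu, lifting step mu nu.
Proof.
have lift1 a : exists nu, lifting step (mdirac a) nu.
  have [[nu hnu]|h] := pselect (exists nu, step a nu).
    by exists nu; exact: lifting_step.
  by exists (mdirac a); apply: lifting_nf => nu hnu; apply: h; exists nu.
have [n [p [p01 [p1 [a ->]]]]] := mdist_dirac_mix mu.
have [nu hnu] := choice (fun j => lift1 (a j)).
by exists (mmix p01 p1 nu); exact: lifting_mix.
Qed.

(** The lifting is not monotone in the relation alone, since [lifting_nf] refers to normal forms;
    hence the second hypothesis. *)
Lemma sub_lifting step1 step2 :
  (forall a nu, step1 a nu -> step2 a nu) ->
  (forall a, (forall nu, ~ step1 a nu) -> forall nu, ~ step2 a nu) ->
  forall mu nu, lifting step1 mu nu -> lifting step2 mu nu.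
Proof.
move=> s12 nf12 mu nu; elim=> [a nfa|a nu' st|n p p01 p1 mu' nu' _ IH].
- by apply: lifting_nf; exact: nf12.
- by apply: lifting_step; exact: s12.
- exact: lifting_mix.
Qed.

End Lifting.

(** * Positions, replacement and substitution *)

Lemma subterm_at_nil (Sig : signature) (V : Type) (s : term Sig V) :
  subterm_at s [::] = Some s.
Proof. by case: s. Qed.

(** Injection on the dependently typed [App] yields an equality of dependent pairs; reading off the
    subterm at [[:: val i]] avoids it. *)
Lemma App_inj (Sig : signature) (V : Type) (f : symb Sig)
    (ts ts' : 'I_(arity f) -> term Sig V) i :
  App f ts = App f ts' -> ts i = ts' i.
Proof.
by move=> /(congr1 (subterm_at ^~ [:: val i])) /=;
  rewrite valK !subterm_at_nil => -[].
Qed.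

Section Positions.
Context {Sig : signature} {V : Type}.
Implicit Types (s t u v : term Sig V) (pi tau : seq nat).

Lemma subterm_at_cat s pi tau :
  subterm_at s (pi ++ tau) = obind (subterm_at ^~ tau) (subterm_at s pi).
Proof.
elim: pi s => [|i pi IH] s; first by rewrite subterm_at_nil.
by case: s => [x|f ts] //=; case: insub => [j|] /=.
Qed.

Lemma replace_at_cat s pi tau t u : subterm_at s pi = Some t ->
  replace_at s (pi ++ tau) u = replace_at s pi (replace_at t tau u).
Proof.
elim: pi s => [|i pi IH] s; first by case: s => [x|f ts] /= [<-].
case: s => [x|f ts] //=; case: insubP => [j _ ji|//] tsj.
congr App; apply: funext => k; case: eqP => // ki; apply: IH.
by have -> : k = j by apply: val_inj; rewrite /= ki.
Qed.

Lemma parallel_cons i j pi tau :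
  parallel (i :: tau) (j :: pi) = (i != j) || parallel tau pi.
Proof. by rewrite /parallel /= eq_sym; case: eqP. Qed.

Lemma parallel_sym tau pi : parallel tau pi = parallel pi tau.
Proof. by rewrite /parallel andbC. Qed.

Lemma subterm_at_replace_parallel s pi tau u : parallel tau pi ->
  subterm_at (replace_at s pi u) tau = subterm_at s tau.
Proof.
elim: pi s tau => [|i pi IH] [x|f ts] [|k tau] //=.
rewrite parallel_cons => par.
case: insubP => // j _ jk; case: eqP => // ji.
by apply: IH; move: par; rewrite -jk -ji eqxx.
Qed.

Lemma replace_at_parallel s pi tau u v : parallel tau pi ->
  replace_at (replace_at s pi u) tau v = replace_at (replace_at s tau v) pi u.
Proof.
elim: pi s tau => [|i pi IH] [x|f ts] [|k tau] //=.
rewrite parallel_cons => par; congr App; apply: funext => j /=.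
case: (eqVneq (val j) k) => [jk|]; case: (eqVneq (val j) i) => [ji|] //=.
by apply: IH; move: par; rewrite -jk -ji eqxx.
Qed.

Lemma subst_inj_occurs (W : Type) (sg sg' : V -> term Sig W) t :
  subst sg t = subst sg' t -> forall x, occurs x t -> sg x = sg' x.
Proof.
elim: t => [y|f ts IH] /= e x; first by move=> ->.
by move=> [i xi]; apply: (IH i) => //; exact: (App_inj i e).
Qed.

Lemma eq_subst_occurs (W : Type) (sg sg' : V -> term Sig W) t :
  (forall x, occurs x t -> sg x = sg' x) -> subst sg t = subst sg' t.
Proof.
elim: t => [y|f ts IH] /= e; first exact: e.
by congr App; apply: funext => i; apply: IH => x xi; apply: e; exists i.
Qed.

Lemma subst_subst (W X : Type) (sg : V -> term Sig W) (th : W -> term Sig X) t :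
  subst th (subst sg t) = subst (subst th \o sg) t.
Proof.
by elim: t => //= f ts IH; congr App; apply: funext => i; exact: IH.
Qed.

End Positions.

(** * Innermost steps and their diamond property *)

Section Rewriting.
Context {R : realType} {Sig : signature} {V : Type} (S : PTRS R Sig V).
Local Notation T := (term Sig V).
Implicit Types (s t u : T) (mu nu : mdist R T) (pi tau : seq nat).
Implicit Types (r : prule R Sig V) (sg : V -> T).

(** Left-hand sides with a common instance unify once renamed apart, so distinct rules would overlap
    at the root. *)
Lemma subst_lhs_eq_rule r1 r2 sg1 sg2 : non_overlapping S -> S r1 -> S r2 ->
  subst sg1 (lhs r1) = subst sg2 (lhs r2) -> r1 = r2.
Proof.
move=> novl Sr1 Sr2 e; apply: contrapT => r12; apply: (novl r1 r2) => //.
exists [::], (subst (fun x => Var (inl x)) (lhs r1)); split => //.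
- exact: subterm_at_nil.
- case: (lhs r1) (@lhs_nonvar _ _ _ r1) => [x|f ts] /= nvar [y]//.
  by case: nvar; exists x.
(* The unifier is [sg1] on the left copy of the variables and [sg2] on the right copy, with values
   moved into [V + V] by [inl]. *)
- exists (fun x => match x with
    | inl y => subst (fun z => Var (inl z)) (sg1 y)
    | inr y => subst (fun z => Var (inl z)) (sg2 y)
    end).
  rewrite !subst_subst.
  have E sg l : subst (fun z => Var (inl z)) (subst sg l) =
    subst (fun y => subst (fun z => Var (@inl V V z)) (sg y)) l.
    by rewrite subst_subst.
  by rewrite -[LHS]E -[RHS]E e.
Qed.

(** The rule is unique, and two matching substitutions agree on the variables of its left-hand side,
    hence on those of its right-hand side. *)
Lemma rewrites_at_functional pi r1 r2 sg1 sg2 s mu nu : non_overlapping S ->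
  rewrites_at S pi r1 sg1 s mu -> rewrites_at S pi r2 sg2 s nu -> mu = nu.
Proof.
move=> novl [Sr1 e1 ->] [Sr2]; rewrite e1 => -[e] ->.
have r12 := subst_lhs_eq_rule novl Sr1 Sr2 e; subst r2.
apply: eq_in_mdmap => t tr; congr replace_at; apply: eq_subst_occurs => x xt.
exact: subst_inj_occurs e _ (rhs_vars tr xt).
Qed.

Lemma rewrites_at_cat s pi tau r sg t mu : subterm_at s pi = Some t ->
  rewrites_at S tau r sg t mu ->
  rewrites_at S (pi ++ tau) r sg s (mdmap (replace_at s pi) mu).
Proof.
move=> st [Sr tl ->]; split => //; first by rewrite subterm_at_cat st.
rewrite mdmap_comp; congr mdmap; apply: funext => u /=.
by rewrite (replace_at_cat _ _ st).
Qed.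

Lemma normal_form_subterm s pi t : subterm_at s pi = Some t ->
  normal_form S s -> normal_form S t.
Proof.
move=> st nfs mu [tau [r [sg h]]].
apply: (nfs (mdmap (replace_at s pi) mu)); exists (pi ++ tau), r, sg.
exact: rewrites_at_cat st h.
Qed.

Lemma redex_not_normal_form r sg : S r -> ~ normal_form S (subst sg (lhs r)).
Proof.
move=> Sr nf; apply: nf; exists [::], r, sg; split; rewrite ?subterm_at_nil//.
Qed.

Lemma istep_at_below pi s mu tau u : istep_at S pi s mu -> tau != [::] ->
  subterm_at s (pi ++ tau) = Some u -> normal_form S u.
Proof.
move=> [r [sg [[Sr sl _] inner]]] tau0 su; apply: inner; exists tau => //.
by move: su; rewrite subterm_at_cat sl.
Qed.

(** Were one position a proper prefix of the other, the lower redex would be a proper subterm of an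
    innermost redex, hence a normal form. *)
Lemma istep_at_parallel pi tau s mu nu :
  istep_at S pi s mu -> istep_at S tau s nu -> pi != tau -> parallel pi tau.
Proof.
have not_below p q rho rho' : istep_at S p s rho -> istep_at S q s rho' ->
    p != q -> ~~ prefix p q.
  move=> pst [r [sg [[Sr sl _] _]]] pq; apply/negP => /prefixP[p' qE].
  rewrite qE in sl; apply: (redex_not_normal_form (sg := sg) Sr).
  apply: istep_at_below pst _ sl; apply: contra_neq pq => p'0.
  by rewrite qE p'0 cats0.
move=> hpi htau pitau; apply/andP; split; first exact: not_below hpi htau _.
by apply: not_below htau hpi _; rewrite eq_sym.
Qed.

Lemma istep_replace_parallel tau pi r sg s mu u :
  rewrites_at S tau r sg s mu ->
  (forall v, proper_subterm v (subst sg (lhs r)) -> normal_form S v) ->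
  parallel tau pi -> istep S (replace_at s pi u)
    (mdmap (replace_at (replace_at s pi u) tau) (mdmap (subst sg) (rhs r))).
Proof.
move=> [Sr sl _] inner par; exists tau, r, sg; split => //.
by rewrite mdmap_comp; split; rewrite ?subterm_at_replace_parallel.
Qed.

(** [P] and [Q] are the distributions of the contracta alone. As [u] is arbitrary, each step stays
    possible in every outcome of the other. *)
Lemma istep_diamond t mu nu : non_overlapping S ->
  istep S t mu -> istep S t nu ->
  mu = nu \/ exists pi tau (P Q : mdist R T),
    [/\ mu = mdmap (replace_at t pi) P, nu = mdmap (replace_at t tau) Q,
      parallel pi tau,
      forall u, istep S (replace_at t tau u)
        (mdmap (replace_at (replace_at t tau u) pi) P) &
      forall u, istep S (replace_at t pi u)
        (mdmap (replace_at (replace_at t pi u) tau) Q)].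
Proof.
move=> novl [pi pimu] [tau taunu].
have [pitau|/(istep_at_parallel pimu taunu) par] := eqVneq pi tau.
  left; subst tau.
  case: pimu => r [sg [rew _]]; case: taunu => r' [sg' [rew' _]].
  exact: rewrites_at_functional novl rew rew'.
right; case: pimu => r [sg [rew inner]]; case: taunu => r' [sg' [rew' inner']].
exists pi, tau, (mdmap (subst sg) (rhs r)), (mdmap (subst sg') (rhs r')).
split => //.
- by rewrite mdmap_comp; case: rew.
- by rewrite mdmap_comp; case: rew'.
- by move=> u; exact: istep_replace_parallel rew inner par.
- move=> u; apply: istep_replace_parallel rew' inner' _.
  by rewrite parallel_sym.
Qed.

(** * Leftmost innermost steps and normal forms *)

Lemma istep_step t mu : istep S t mu -> step S t mu.
Proof. by move=> [pi [r [sg [h _]]]]; exists pi, r, sg. Qed.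

Lemma listep_istep t mu : listep S t mu -> istep S t mu.
Proof. by move=> [pi [h _]]; exists pi. Qed.

Lemma left_of_cons i j tau pi : left_of (i :: tau) (j :: pi) ->
  (i < j)%N \/ i = j /\ left_of tau pi.
Proof.
rewrite /left_of parallel_cons /=; case: (eqVneq i j) => [->|ij] /= [par].
  case=> a [b []] /=; rewrite eqxx /= => pa pb ab; right; split => //.
  by split => //; exists a, b; split.
by case=> a [b []] /=; rewrite !prefix0s !andbT => /eqP -> /eqP ->; left.
Qed.

(** Descends into the leftmost argument that is not a normal form; if all arguments are normal
    forms, the root is contracted. *)
Lemma listep_exists t : ~ normal_form S t -> exists mu, listep S t mu.
Proof.
elim: t => [x|f ts IH] nnf.
  case: nnf => mu [[|i pi] [r [sg [_ //=]]]] [e] _.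
  by case: (@lhs_nonvar _ _ _ r); case: (lhs r) e => // y; exists y.
have sub1 (i : 'I_(arity f)) : subterm_at (App f ts) [:: val i] = Some (ts i).
  by rewrite /= valK subterm_at_nil.
have [[i nnfi]|nfts] := pselect (exists i, ~ normal_form S (ts i)).
  have [j /asboolP nnfj jmin] :=
    @arg_minnP _ i (fun i => `[< ~ normal_form S (ts i) >])
      (@nat_of_ord _) (asboolT nnfi).
  have [mu [pi [[r [sg [rew inner]]] left]]] := IH _ nnfj.
  exists (mdmap (replace_at (App f ts) [:: val j]) mu), (val j :: pi); split.
    by exists r, sg; split => //; exact: (rewrites_at_cat (sub1 j) rew).
  (* A redex further left lies in an earlier argument, excluded by minimality of [j], or in the same
     one, excluded by induction. *)
  move=> [|k tau] u; first by move=> [].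
  move=> /left_of_cons [kj|[-> ltau]] /=; last by rewrite valK; exact: left.
  case: insubP => // k' _ k'k su [r' [sg' [Sr' uE]]].
  suff : (j <= k')%N by rewrite leqNgt -[X in (X < _)%N]/(val k') k'k kj.
  apply: jmin; apply/asboolP => /(normal_form_subterm su).
  by rewrite uE; exact: redex_not_normal_form.
have nfargs i : normal_form S (ts i).
  by apply: contrapT => h; apply: nfts; exists i.
have [mu [pi [r [sg rew]]]] : exists mu, step S (App f ts) mu.
  by apply: contrapT => h; apply: nnf => mu hmu; apply: h; exists mu.
have nfsub i q u : subterm_at (App f ts) (i :: q) = Some u -> normal_form S u.
  by move=> /=; case: insubP => // k _ _ su; exact: normal_form_subterm su _.
case: pi rew => [|i pi] rew; last first.
  by case: rew => Sr sl _; case: (redex_not_normal_form Sr (nfsub _ _ _ sl)).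
exists mu, [::]; split; last by move=> tau u [] /andP[]; rewrite prefix0s.
exists r, sg; split => // u [[|i q] // _]; case: rew => _ [<-] _.
exact: nfsub.
Qed.

(** By [listep_exists], restricting the strategy creates no new normal forms. *)
Lemma normal_form_istep t : (forall mu, ~ istep S t mu) <-> normal_form S t.
Proof.
split=> [nf|nf mu /istep_step]; last exact: nf.
by apply: contrapT => /listep_exists[mu /listep_istep]; exact: nf.
Qed.

Lemma normal_form_listep t : (forall mu, ~ listep S t mu) <-> normal_form S t.
Proof.
split=> [nf|nf mu /listep_istep/istep_step]; last exact: nf.
by apply: contrapT => /listep_exists[mu]; exact: nf.
Qed.

Lemma lifting_listep_istep mu nu :
  lifting (listep S) mu nu -> lifting (istep S) mu nu.
Proof.
apply: sub_lifting => a; first exact: listep_istep.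
by move=> /normal_form_listep/normal_form_istep.
Qed.

(** * Probability of a normal form after n innermost steps *)

Definition some_istep t : mdist R T :=
  if pselect (exists mu, istep S t mu) is left ex then projT1 (cid ex)
  else mdirac t.

(** Probability of reaching a normal form from [t] within [n] steps, each being the one fixed by
    [some_istep]. *)
Fixpoint nf_prob_within (n : nat) t : R :=
  if n is m.+1 then expect (some_istep t) (nf_prob_within m)
  else (`[< normal_form S t >])%:R.

Lemma nf_prob_expect mu : nf_prob S mu = expect mu (nf_prob_within 0).
Proof.
rewrite /nf_prob big_mkcond; apply: eq_bigr => x _ /=.
by case: ifP => _; rewrite ?mulr1 ?mulr0.
Qed.

Lemma nf_prob_within_normal_form n t : normal_form S t ->
  nf_prob_within n t = 1.
Proof.
move=> nft; elim: n => [|n IH] /=; first by rewrite asboolT.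
rewrite /some_istep; case: pselect => [[mu]|_]; last by rewrite expect_dirac.
by move=> tmu; case: (nft _ (istep_step tmu)).
Qed.

(** The choice made by [some_istep] is immaterial: the diamond property compares it with the given
    step, and induction lets each outcome continue with the step left over. *)
Lemma nf_prob_within_istep n t mu : non_overlapping S -> istep S t mu ->
  nf_prob_within n.+1 t = expect mu (nf_prob_within n).
Proof.
move=> novl tmu; elim: n t mu tmu => [|n IH] t mu tmu;
  rewrite [LHS]/= /some_istep;
  (case: pselect => [ex|]; last by case; exists mu);
  case: (cid ex) => nu /= tnu {ex};
  have [->//|[pi [tau [P [Q]]]]] := istep_diamond novl tmu tnu;
  move=> [-> -> par stepP stepQ];
  rewrite !expect_map.
(* Both sides vanish: after one step, each outcome still contains the other redex. *)
- rewrite /expect !big1// => x _ /=; rewrite asboolF ?mulr0// => nf.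
    exact: nf _ (istep_step (stepQ x.2)).
  exact: nf _ (istep_step (stepP x.2)).
(* Stepping at [tau] and then at [pi] gives a double expectation; exchanging the sums and the
   parallel replacements gives the opposite order. *)
- transitivity (expect Q (fun u => expect P (fun v =>
      nf_prob_within n (replace_at (replace_at t tau u) pi v)))).
    apply: eq_expect => u.
    by rewrite -[LHS]/(nf_prob_within n.+1 _) (IH _ _ (stepP u)) expect_map.
  rewrite exchange_expect; apply: eq_expect => v.
  rewrite -[RHS]/(nf_prob_within n.+1 _) (IH _ _ (stepQ v)) expect_map.
  by apply: eq_expect => u; rewrite /= replace_at_parallel.
Qed.

(** A lifted step uses up one unit of the index. Normal forms stay put, but their value is 1 at
    every index. *)
Lemma expect_lifting_istep n mu nu : non_overlapping S ->
  lifting (istep S) mu nu ->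
  expect nu (nf_prob_within n) = expect mu (nf_prob_within n.+1).
Proof.
move=> novl; elim=> [t nft|t mu' st|k p p01 p1 mu' nu' _ IH].
- by rewrite !expect_dirac !nf_prob_within_normal_form//;
    exact/normal_form_istep.
- by rewrite expect_dirac (nf_prob_within_istep _ novl st).
- by rewrite !expect_mix; apply: eq_bigr => j _; rewrite IH.
Qed.

Lemma nf_prob_istep_seq (mu : nat -> mdist R T) n : non_overlapping S ->
  rewrite_seq (istep S) mu ->
  nf_prob S (mu n) = expect (mu 0%N) (nf_prob_within n).
Proof.
move=> novl seqmu; rewrite nf_prob_expect.
(* Generalised to [m] further steps, as the induction on [k] moves one step at a time into the
   index. *)
suff E k m : expect (mu k) (nf_prob_within m) =
    expect (mu 0%N) (nf_prob_within (k + m)) by rewrite E addn0.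
elim: k m => // k IH m.
by rewrite (expect_lifting_istep _ novl (seqmu k)) IH addnS.
Qed.

(** * From innermost to leftmost innermost sequences *)

Lemma rewrite_seq_exists (red : T -> mdist R T -> Prop) mu0 :
  exists2 mu, rewrite_seq red mu & mu 0%N = mu0.
Proof.
have [next hnext] := choice (lifting_total red).
by exists (fun n => iter n next mu0) => // n; exact: hnext.
Qed.

Lemma istep_seq_listep (mu : nat -> mdist R T) : non_overlapping S ->
  rewrite_seq (istep S) mu ->
  exists2 nu, rewrite_seq (listep S) nu &
    (fun n => nf_prob S (nu n)) = (fun n => nf_prob S (mu n)).
Proof.
move=> novl seqmu.
have [nu seqnu nu0] := rewrite_seq_exists (listep S) (mu 0%N).
exists nu => //; apply: funext => n.
have iseqnu : rewrite_seq (istep S) nu.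
  by move=> k; exact: lifting_listep_istep.
rewrite (nf_prob_istep_seq _ novl iseqnu) (nf_prob_istep_seq _ novl seqmu).
by rewrite nu0.
Qed.

End Rewriting.

Theorem theorem4p7 (R : realType) (Sig : signature) (V : Type)
    (S : PTRS R Sig V) (S_nonoverlapping : non_overlapping S) :
  (iAST S <-> liAST S) /\ (iPAST S <-> liPAST S).
Proof.
split; split => h mu seqmu.
- by apply: h => n; exact: lifting_listep_istep.
- by have [nu /h seqnu <-] := istep_seq_listep S_nonoverlapping seqmu.
- by apply: h => n; exact: lifting_listep_istep.
- have [nu /h seqnu E] := istep_seq_listep S_nonoverlapping seqmu.
  (* [edl] depends on a sequence only through its values of [nf_prob]. *)
  suff -> : edl S mu = edl S nu by [].
  by apply: eq_eseriesr => n _; rewrite (congr1 (@^~ n) E).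
Qed.
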